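(* Let $\mathbf{F}$ be a continuous bundle random dynamical system over $(\Omega,\mathcal{F},\mathbb{P},G)$ with compact metric state space $X$ and total space $\mathcal{E}\in\mathcal{F}\times\mathcal{B}_X$. Assume that $\Omega$ is a zero-dimensional compact metric space with $\mathcal{F}=\mathcal{B}_\Omega$. Then each member of $\mathbf{C}^{t,o}_{\mathcal{E}}$ is factor excellent, where $\mathbf{C}^{t,o}_{\mathcal{E}}$ is the set of all $\mathcal{U}\cap\mathcal{E}=\{U\cap\mathcal{E}:U\in\mathcal{U}\}$ with $\mathcal{U}$ a finite open cover of the topological space $\Omega\times X$.
   Context: **Setting.** $G$ is an infinite countable discrete amenable group with identity $e_G$. $(\Omega,\mathcal{F},\mathbb{P})$ is a Lebesgue (in particular complete) probability space on which $G$ acts by invertible measure-preserving transformations, $e_G$ acting as the identity. ($\mathcal{B}_\Omega$ is the Borel $\sigma$-algebra, not distinguished from its $\mathbb{P}$-completion; a space is zero-dimensional if it has a base of clopen sets.) $X$ is a compact metric space with Borel $\sigma$-algebra $\mathcal{B}_X$, $\mathcal{E}\in\mathcal{F}\times\mathcal{B}_X$, and $A_\omega=\{x:(\omega,x)\in A\}$ for $A\subseteq\Omega\times X$. A continuous bundle random dynamical system (RDS) over $(\Omega,\mathcal{F},\mathbb{P},G)$ is a family $\mathbf{F}=\{F_{g,\omega}:\mathcal{E}_\omega\to\mathcal{E}_{g\omega}\mid g\in G,\omega\in\Omega\}$ such that $F_{e_G,\omega}=\mathrm{id}$; $(\omega,x)\mapsto F_{g,\omega}(x)$ is measurable on $\mathcal{E}$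 for each $g$; $F_{g_2,g_1\omega}\circ F_{g_1,\omega}=F_{g_2g_1,\omega}$ for all $\omega,g_1,g_2$; and for $\mathbb{P}$-a.e. $\omega$, $\mathcal{E}_\omega$ is non-empty compact and every $F_{g,\omega}$ is continuous. $\mathcal{P}_{\mathbb{P}}(\mathcal{E})$ is the set of probability measures on $\Omega\times X$ with marginal $\mathbb{P}$ and $\mu(\mathcal{E})=1$. **Covers.** $\mathbf{C}_{\mathcal{E}}$ (resp. $\mathbf{P}_{\mathcal{E}}$): finite measurable covers (resp. partitions) of $\mathcal{E}$. $\mathbf{C}^o_{\mathcal{E}}$: those $\mathcal{U}\in\mathbf{C}_{\mathcal{E}}$ such that for each $U\in\mathcal{U}$, $U_\omega$ is open in $\mathcal{E}_\omega$ for $\mathbb{P}$-a.e. $\omega$. $\mathcal{U}_\omega=\{U_\omega:U\in\mathcal{U}\}$. Note $\mathbf{C}^{t,o}_{\mathcal{E}}\subseteq\mathbf{C}^o_{\mathcal{E}}$. **Excellent covers.** $\mathcal{F}_{\mathcal{E}}=\{(A\times X)\cap\mathcal{E}:A\in\mathcal{F}\}$; $H_\mu(\alpha|\mathcal{C})=-\sum_{A\in\alpha}\int\mu(A|\mathcal{C})\log\mu(A|\mathcal{C})\,d\mu$ for $\alpha\in\mathbf{P}_{\mathcal{E}}$ and a sub-$\sigma$-algebra $\mathcal{C}$; $\alpha\vee\mathcal{C}$ is the $\sigma$-algebra generated by $\alpha$ and $\mathcal{C}$. For $\mathcal{U}=\{U_1,\dots,U_N\}\in\mathbf{C}_{\mathcal{E}}$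 let $\mathbf{P}_{\mathcal{U}}=\{\{A_1,\dots,A_N\}\in\mathbf{P}_{\mathcal{E}}:A_i\subseteq U_i\ \forall i\}$. $\mathcal{U}$ is *excellent* if there is a sequence $\{\alpha_n\}\subseteq\mathbf{P}_{\mathcal{U}}$ such that for each $n$, $(\alpha_n)_\omega$ is a partition of $\mathcal{E}_\omega$ into clopen sets for $\mathbb{P}$-a.e. $\omega$, and $\inf_n[H_\mu(\beta|\alpha_n\vee\mathcal{F}_{\mathcal{E}})+H_\mu(\alpha_n|\beta\vee\mathcal{F}_{\mathcal{E}})]=0$ for every $\beta\in\mathbf{P}_{\mathcal{U}}$ and $\mu\in\mathcal{P}_{\mathbb{P}}(\mathcal{E})$. A factor map between continuous bundle RDS's $\mathbf{F}_1$ (on $\mathcal{E}_1$) and $\mathbf{F}_2$ (on $\mathcal{E}_2$) over $(\Omega,\mathcal{F},\mathbb{P},G)$, with possibly different compact metric state spaces, is a measurable map $\pi:\mathcal{E}_1\to\mathcal{E}_2$ over the identity of $\Omega$ such that for $\mathbb{P}$-a.e. $\omega$ the restriction $\pi_\omega:(\mathcal{E}_1)_\omega\to(\mathcal{E}_2)_\omega$ is a continuous surjection and $\pi_{g\omega}\circ(F_1)_{g,\omega}=(F_2)_{g,\omega}\circ\pi_\omega$ for all $g\in G$. $\mathcal{U}\in\mathbf{C}^o_{\mathcal{E}}$ is *factor excellent* if there is a factor map $\pi$ from some continuous bundle RDS over $(\Omega,\mathcal{F},\mathbb{P},G)$ to $\mathbf{F}$ such that $\pi^{-1}(\mathcal{U})$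 is excellent. *)

(* Defs.v *)
From HB Require Import structures.
From mathcomp Require Import all_boot all_order all_algebra finmap.
From mathcomp Require Import all_classical all_reals all_analysis.

Set Implicit Arguments.
Unset Strict Implicit.
Unset Printing Implicit Defensive.

Import Order.TTheory GRing.Theory Num.Theory.
Import numFieldNormedType.Exports.

Local Open Scope classical_set_scope.
Local Open Scope ring_scope.

(* Measurable types of the library are pointed, and so are the state spaces
   here. This is no restriction: almost every fibre of a bundle over a
   probability space is nonempty. *)
#[short(type="pmetricType")]
HB.structure Definition PointedMetric (R : numDomainType) :=
  {T of Metric R T & Pointed T}.

#[short(type="measurableMetricType")]
HB.structure Definition MeasurableMetric (R : numDomainType) d :=
  {T of Metric R T & Measurable d T}.

(* The type X equipped with its Borel sigma-algebra. *)
Notation borel X := (g_sigma_algebraType (@open X)).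

Definition has_clopen_base (T : topologicalType) : Prop :=
  exists2 B : set (set T), basis B & B `<=` clopen.

(* The sigma-algebra of P, i.e. the one carried by the measurable type T, is
   the P-completion of <<s B >>. *)
Definition is_completion_of (R : realType) d (T : measurableType d)
    (P : probability T R) (B : set (set T)) : Prop :=
  <<s B >> `<=` measurable /\
  forall A : set T, measurable A <->
    exists A1 A2 : set T,
      [/\ <<s B >> A1, <<s B >> A2, A1 `<=` A, A `<=` A2 & P (A2 `\` A1) = 0%E].

(* Existence of a (left) Folner sequence. *)
Definition amenable (R : realType) (G : groupType) : Prop :=
  exists K : nat -> {fset G},
    (forall n, K n != fset0) /\
    forall g : G,
      (let gK n := [fset (g * x)%g | x in K n]%fset in
       (#|` (gK n `\` K n) `|` (K n `\` gK n)|%fset)%:R / (#|` K n|)%:R : R)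
        @[n --> \oo] --> (0 : R).

Record mp_action (R : realType) d (Omega : measurableType d)
    (P : probability Omega R) (G : groupType) (act : G -> Omega -> Omega) :
    Prop := MPAction {
  mp_action1 : forall w, act 1%g w = w ;
  mp_actionM : forall g h w, act (g * h)%g w = act g (act h w) ;
  mp_action_measurable : forall g, measurable_fun setT (act g) ;
  mp_action_preserving : forall g (A : set Omega), measurable A ->
    P (act g @^-1` A) = P A }.

Section random_dynamical_systems.
Context (R : realType) d (Omega : measurableType d) (P : probability Omega R).
Context (G : groupType) (act : G -> Omega -> Omega).

(* Fg g w x stands for F_{g,w}(x); it is a total function of which only the
   values at x in the fibre of E over w are ever used. *)
Record continuous_bundle_rds (X : pmetricType R) (E : set (Omega * X))
    (Fg : G -> Omega -> X -> X) : Prop := ContinuousBundleRDS {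
  rds_compact : compact [set: X] ;
  rds_measurableE : measurable (E : set (Omega * borel X)) ;
  rds_maps : forall g w x, E (w, x) -> E (act g w, Fg g w x) ;
  rds1 : forall w x, E (w, x) -> Fg 1%g w x = x ;
  rds_measurable : forall g,
    measurable_fun (E : set (Omega * borel X))
      ((fun z => Fg g z.1 z.2) : Omega * borel X -> borel X) ;
  rdsM : forall g1 g2 w x, E (w, x) ->
    Fg g2 (act g1 w) (Fg g1 w x) = Fg (g2 * g1)%g w x ;
  rds_fiber : {ae P, forall w,
    [/\ xsection E w !=set0, compact (xsection E w) &
        forall g, {within xsection E w, continuous (Fg g w)}]} }.

Definition factor_map (X1 X2 : pmetricType R)
    (E1 : set (Omega * X1)) (F1 : G -> Omega -> X1 -> X1)
    (E2 : set (Omega * X2)) (F2 : G -> Omega -> X2 -> X2)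
    (pi : Omega * X1 -> Omega * X2) : Prop :=
  [/\ forall z, E1 z -> E2 (pi z),
      forall z, E1 z -> (pi z).1 = z.1,
      measurable_fun (E1 : set (Omega * borel X1))
        (pi : Omega * borel X1 -> Omega * borel X2) &
      {ae P, forall w, let pi_ w x := (pi (w, x)).2 in
        [/\ {within xsection E1 w, continuous (pi_ w)},
            pi_ w @` xsection E1 w = xsection E2 w &
            forall g x, xsection E1 w x ->
              pi_ (act g w) (F1 g w x) = F2 g w (pi_ w x)]}].

(* Finite covers and partitions are families indexed by 'I_N; members may be
   empty or repeated (distinct indices of a partition carry disjoint sets). *)
Definition measurable_cover (X : pmetricType R) (E : set (Omega * X)) (N : nat)
    (U : 'I_N -> set (Omega * X)) : Prop :=
  (forall i, measurable (U i : set (Omega * borel X))) /\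
  \bigcup_(i in [set: 'I_N]) U i = E.

Definition measurable_partition (X : pmetricType R) (E : set (Omega * X))
    (N : nat) (A : 'I_N -> set (Omega * X)) : Prop :=
  measurable_cover E A /\ trivIset [set: 'I_N] A.

Definition random_open_cover (X : pmetricType R) (E : set (Omega * X)) (N : nat)
    (U : 'I_N -> set (Omega * X)) : Prop :=
  measurable_cover E U /\
  forall i, {ae P, forall w,
    open (xsection (U i) w : set (subspace (xsection E w)))}.

Definition subordinate_partition (X : pmetricType R) (E : set (Omega * X))
    (N : nat) (U A : 'I_N -> set (Omega * X)) : Prop :=
  measurable_partition E A /\ forall i, A i `<=` U i.

Section entropy.
Context (X : pmetricType R) (mu : probability (Omega * borel X)%type R).
Context (E : set (Omega * X)).

(* In this section C is a sub-sigma-algebra of the trace sigma-algebra on E. *)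

Definition is_cond_prob (C : set (set (Omega * X))) (A : set (Omega * X))
    (f : Omega * X -> R) : Prop :=
  [/\ preimage_set_system E f measurable `<=` C,
      mu.-integrable E (EFin \o f) &
      forall B, C B -> (\int[mu]_(z in B) (f z)%:E = mu (A `&` B))%E].

(* A version of mu(A|C): one exists by the Radon-Nikodym theorem, and it is
   unique up to a mu-null subset of E. *)
Definition cond_prob (C : set (set (Omega * X))) (A : set (Omega * X)) :
    Omega * X -> R :=
  xget (cst 0) [set f | is_cond_prob C A f].

(* The library has ln x = 0 for x <= 0, so 0 * ln 0 = 0. *)
Definition cond_entropy (N : nat) (A : 'I_N -> set (Omega * X))
    (C : set (set (Omega * X))) : \bar R :=
  (- \sum_(i < N)
      \int[mu]_(z in E) (cond_prob C (A i) z * ln (cond_prob C (A i) z))%:E)%E.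

Definition base_sigma : set (set (Omega * X)) :=
  [set (A `*` [set: X]) `&` E | A in (measurable : set (set Omega))].

Definition join_sigma (N : nat) (A : 'I_N -> set (Omega * X))
    (C : set (set (Omega * X))) : set (set (Omega * X)) :=
  <<s E, range A `|` C >>.

Definition bundle_measure : Prop :=
  (forall A : set Omega, measurable A -> mu (A `*` [set: X]) = P A) /\
  mu E = 1%E.

End entropy.

Definition excellent (X : pmetricType R) (E : set (Omega * X)) (N : nat)
    (U : 'I_N -> set (Omega * X)) : Prop :=
  measurable_cover E U /\
  exists alpha : nat -> 'I_N -> set (Omega * X),
    [/\ forall n, subordinate_partition E U (alpha n),
        forall n, {ae P, forall w, forall i,
          clopen (xsection (alpha n i) w : set (subspace (xsection E w)))} &
        forall (beta : 'I_N -> set (Omega * X))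
               (mu : probability (Omega * borel X)%type R),
          subordinate_partition E U beta -> bundle_measure mu E ->
          ereal_inf (range (fun n =>
            cond_entropy mu E beta (join_sigma E (alpha n) (base_sigma E)) +
            cond_entropy mu E (alpha n) (join_sigma E beta (base_sigma E)))%E)
          = 0%E].

Definition factor_excellent (X : pmetricType R) (E : set (Omega * X))
    (Fg : G -> Omega -> X -> X) (N : nat) (U : 'I_N -> set (Omega * X)) :
    Prop :=
  random_open_cover E U /\
  exists (X' : pmetricType R) (E' : set (Omega * X'))
         (Fg' : G -> Omega -> X' -> X') (pi : Omega * X' -> Omega * X),
    [/\ continuous_bundle_rds E' Fg',
        factor_map E' Fg' E Fg pi &
        excellent E' (fun i => E' `&` pi @^-1` U i)].

End random_dynamical_systems.

(* Main.v *)
From HB Require Import structures.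
Require Import Defs.
From mathcomp Require Import all_boot all_order all_algebra finmap.
From mathcomp Require Import all_classical all_reals all_analysis.
From mathcomp Require Import measurable_realfun lra.

(** The given system is extended to one whose state space is a Cantor space M, so
    that Omega * M is compact and zero-dimensional.

    By the Alexandroff-Hausdorff theorem there is a continuous surjection phi
    from the Cantor space onto X. As G * nat is countable, a point of M encodes
    a G-indexed family of points of the Cantor space. The extension consists of
    the pairs (w, y) such that the points encoded by y are mapped by phi onto the
    orbit (F_{g,w}(x))_g of a point x of E_w; G acts on y by the shift, and the
    factor map sends (w, y) to (w, x). Almost every fibre is closed in M, because
    the maps F_{g,w} are continuous on the compact set E_w ([ext_rds],
    [ext_factor_map]).

    An open cover of Omega * X pulls back to an open cover U of Omega * M, and
    the traces of such covers are excellent ([zero_dimensional_excellent]). A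
    compact pseudometric space has countably many clopen sets, hence countably
    many clopen partitions subordinate to U; their traces are the sequence
    alpha_n. The clopen sets generate the sigma-algebra of Omega * M up to the
    null sets added by completion, so that a measurable partition beta
    subordinate to U is approximated in measure by clopen partitions; these can
    be kept subordinate to U because each U_i is a countable union of clopen
    sets ([clopen_partition_approximation]). Finally, if alpha_i and beta_i
    differ by little for every i, both conditional entropies are small. This
    follows from tangent-line bounds on - t ln t integrated over beta_i and over
    its complement ([cond_prob_entropy_bounds], [cond_entropy_bounds]). *)

Set Implicit Arguments.
Unset Strict Implicit.
Unset Printing Implicit Defensive.

Import Order.TTheory GRing.Theory Num.Theory.
Import numFieldNormedType.Exports.

Local Open Scope classical_set_scope.
Local Open Scope ring_scope.

(** * The Cantor space as a metric space *)

(** Binary sequences, with the R-valued distance 2^-n where n is the first index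
    at which two sequences differ: a metric copy of [cantor_space] *)
Definition cantor_metric (R : realType) : Type := nat -> bool.

Section cantor_metric.
Context (R : realType).
Local Notation M := (cantor_metric R).
Implicit Types x y z : M.

HB.instance Definition _ := Choice.on M.
HB.instance Definition _ := isPointed.Build M (fun=> false).

Definition cantor_dist x y : R :=
  if pselect (exists n, x n != y n) is left xy then 2^-1 ^+ ex_minn xy else 0.

(** Together with [le_cantor_dist], this determines [cantor_dist]. *)
Lemma cantor_distP x y :
  (x = y /\ cantor_dist x y = 0) \/
  exists2 n, x n != y n & cantor_dist x y = 2^-1 ^+ n.
Proof.
rewrite /cantor_dist; case: pselect => [xy|/forallNP xy]; [right|left].
  by case: ex_minnP => n ? _; exists n.
by split => //; apply/funext => n; have /negP/negPn/eqP := xy n.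
Qed.

Lemma le_cantor_dist x y n : x n != y n -> 2^-1 ^+ n <= cantor_dist x y.
Proof.
move=> xyn; rewrite /cantor_dist; case: pselect => [xy|]; last by case; exists n.
case: ex_minnP => m _ /(_ _ xyn) mn.
by rewrite ler_wiXn2l// ?invr_ge0// invf_le1// ler1n.
Qed.

Lemma cantor_dist_ge0 x y : 0 <= cantor_dist x y.
Proof. by have [[_ ->]//|[n _ ->]] := cantor_distP x y; rewrite exprn_ge0. Qed.

Lemma cantor_distxx x : cantor_dist x x = 0.
Proof. by have [[]//|[n]] := cantor_distP x x; rewrite eqxx. Qed.

Lemma cantor_dist_eq0 x y : cantor_dist x y = 0 -> x = y.
Proof.
have [[]//|[n _ ->] /eqP] := cantor_distP x y.
by rewrite expf_eq0 invr_eq0 (pnatr_eq0 R 2) andbF.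
Qed.

Lemma cantor_dist_sym x y : cantor_dist x y = cantor_dist y x.
Proof.
wlog suff le : x y / cantor_dist x y <= cantor_dist y x.
  by apply/eqP; rewrite eq_le !le.
have [[-> _]//|[n xyn ->]] := cantor_distP x y.
by apply: le_cantor_dist; rewrite eq_sym.
Qed.

Lemma cantor_dist_triangle y x z :
  cantor_dist x z <= cantor_dist x y + cantor_dist y z.
Proof.
have [[-> _]|[n xzn ->]] := cantor_distP x z.
  by rewrite cantor_distxx addr_ge0// cantor_dist_ge0.
have [xyn|/eqP xyn] := eqVneq (x n) (y n).
  by rewrite ler_wpDl ?cantor_dist_ge0// le_cantor_dist// -xyn.
by rewrite ler_wpDr ?cantor_dist_ge0// le_cantor_dist//; apply/eqP.
Qed.

HB.instance Definition _ := isMetric.Build R M cantor_distxx cantor_dist_eq0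
  cantor_dist_sym cantor_dist_triangle.

Lemma cantor_coord_continuous n : continuous (fun x : M => x n).
Proof.
move=> x A /nbhs_singleton Axn; apply/nbhs_ballP; exists (2^-1 ^+ n) => /=.
  by rewrite exprn_gt0.
move=> y; rewrite ballEmdist/= => xy.
suff <- : x n = y n by [].
by apply/eqP; apply: contraLR xy => xyn; rewrite -leNgt le_cantor_dist.
Qed.

Lemma cantor_continuous (T : topologicalType) (f : T -> M) :
  (forall n, continuous (fun t => f t n)) -> continuous f.
Proof.
move=> cf t A /nbhs_ballP[e /= e0 eA].
have half_lt1 : `|2^-1 : R| < 1 by rewrite ger0_norm ?invr_ge0// invf_lt1 ?ltr1n.
have [n _ /(_ n (leqnn n)) ne] : \forall n \near \oo, (2^-1 : R) ^+ n < e.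
  have /cvgrPdist_lt/(_ _ e0) := cvg_expr half_lt1.
  apply: filterS => n; rewrite sub0r normrN; exact/le_lt_trans/ler_norm.
have : \forall u \near t, forall m, (m < n)%N -> f t m = f u m.
  elim: n {ne} => [|n IHn]; first by apply: nearW.
  have : nbhs (f t n) [set f t n].
    by apply: open_nbhs_nbhs; split => //; exact: discrete_open.
  move=> /(cf n t); apply: filterS2 IHn => u tu ftn m; rewrite ltnS leq_eqVlt.
  by move=> /predU1P[->|/tu//]; exact: esym.
apply: filterS => u tu; apply: eA; rewrite ballEmdist/=.
change (cantor_dist (f t) (f u) < e).
have [[_ ->]//|[m tum d]] := cantor_distP (f t) (f u).
rewrite d; apply: le_lt_trans ne.
rewrite ler_wiXn2l// ?invr_ge0// ?invf_le1// ?ler1n// leqNgt.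
by apply/negP => /tu fm; rewrite fm eqxx in tum.
Qed.

Lemma cantor_zero_dim : zero_dimensional M.
Proof.
move=> x y /eqP xy.
have [n xyn] : exists n, x n != y n.
  apply: contra_notP xy => /forallNP xy; apply/funext => n.
  by have /negP/negPn/eqP := xy n.
exists ((fun z : M => z n) @^-1` [set x n]); split => //=.
  apply: preimage_clopen; last exact: cantor_coord_continuous.
  by split; [exact: discrete_open|exact: discrete_closed].
by apply/eqP; rewrite eq_sym.
Qed.

Lemma cantor_compact : compact [set: M].
Proof.
have cid : continuous (id : cantor_space -> M).
  apply: cantor_continuous => n; exact: (@proj_continuous nat (fun=> bool) n).
have -> : [set: M] = (id : cantor_space -> M) @` [set: cantor_space].
  by rewrite image_id.
apply: continuous_compact; last exact: cantor_space_compact.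
exact: continuous_subspaceT.
Qed.

(** The metric refines the product topology. *)
Lemma cantor_to_space_continuous : continuous (id : M -> cantor_space).
Proof.
move=> x.
have FF : Filter (nbhs x) by exact: nbhs_filter.
have FidF : Filter ((id : M -> cantor_space) @ x) by exact: fmap_filter.
apply/(cvg_sup _ _ FidF) => n; apply/cvg_image.
  rewrite eqEsubset; split=> [//|b _]; by exists (fun=> b).
move=> A Axn; exists ((fun y : M => y n) @^-1` A); last first.
  rewrite eqEsubset; split => [b [y Ay <-]//|b Ab].
  by exists (fun=> b).
exact: cantor_coord_continuous Axn.
Qed.

End cantor_metric.

(** * Second countable and zero-dimensional spaces *)

(** The empty set serves as a default value, so that B may be empty. *)
Lemma seq_of_countable (T : Type) (B : set (set T)) : countable B ->
  exists b : nat -> set T,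
    (forall n, b n = set0 \/ B (b n)) /\ (forall A, B A -> exists n, b n = A).
Proof.
move=> /pcard_injP[f finj].
exists (fun n => if pselect (exists A, B A /\ f A = n) is left h
  then projT1 (cid h) else set0).
split=> [n|A BA].
  case: pselect => [h|]; last by left.
  by right; case: (projT2 (cid h)).
exists (f A); case: pselect => [h|]; last by case; exists A.
have [BA' fA'] := projT2 (cid h).
by apply: finj => //; rewrite inE.
Qed.

Lemma second_countable_seq (T : topologicalType) : @second_countable T ->
  exists b : nat -> set T, (forall n, open (b n)) /\
    forall x V, nbhs x V -> exists n, b n x /\ b n `<=` V.
Proof.
move=> [B /seq_of_countable[b [b0B Bb]] [Bo Bx]]; exists b; split=> [n|x V xV].
  by have [->|/Bo//] := b0B n; exact: open0.
have [A [BA Ax] AV] := Bx x V xV.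
by have [n bn] := Bb A BA; exists n; rewrite bn.
Qed.

Lemma open_prod_measurable (R : realType) d (S : measurableMetricType R d)
    (T : pmetricType R) (W : set (S * T)) :
  (@open S `<=` measurable) -> compact [set: S] -> compact [set: T] ->
  open W -> measurable (W : set (S * borel T)).
Proof.
move=> oS /compact_second_countable/second_countable_seq[b [bo bx]].
move=> /compact_second_countable/second_countable_seq[c [co cx]] Wo.
have -> : W = \bigcup_k \bigcup_l
    (if pselect (b k `*` c l `<=` W) then b k `*` c l else set0).
  rewrite eqEsubset; split=> [[s t] Wst|z [k _ [l _]]]; last first.
    by case: pselect => [bW /bW|_ []].
  have [/= [U V] /= [sU tV] UVW] : nbhs (s, t) W by exact: open_nbhs_nbhs.
  have [k [bs bU]] := bx s U sU; have [l [ct cV]] := cx t V tV.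
  exists k => //; exists l => //; case: pselect => // -[] z [/= bz cz].
  by apply: UVW; split; [exact: bU|exact: cV].
apply: bigcupT_measurable => k; apply: bigcupT_measurable => l.
case: pselect => /= _; last exact: measurable0.
by apply: measurableX; [exact: oS|exact: sub_sigma_algebra].
Qed.

(** A countable base separates the points of T, so that disagreement of f and g
    is a countable union of measurable conditions. *)
Lemma measurable_eq_set (R : realType) d (S : measurableType d)
    (T : pmetricType R) (D : set S) (f g : S -> borel T) :
  compact [set: T] -> measurable D -> measurable_fun D f ->
  measurable_fun D g -> measurable (D `&` [set s | f s = g s]).
Proof.
move=> /compact_second_countable/second_countable_seq[b [bo bx]] mD mf mg.
have -> : D `&` [set s | f s = g s] =
    D `\` \bigcup_n ((D `&` f @^-1` (b n)) `\` (D `&` g @^-1` (b n))).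
  rewrite eqEsubset; split=> [s [Ds /= fgs]|s [Ds nfg]].
    split => // -[n _ [[_ /= bf] []]]; split => //=.
    by rewrite -fgs.
  split => //=; apply: contrapT => fgs; apply: nfg.
  have /(_ _ _)/contra_not : hausdorff_space T by exact: metric_hausdorff.
  move=> /(_ _ _ fgs); rewrite /cluster /= => /existsNP[U /existsNP[V]].
  move=> /not_implyP[fU /not_implyP[gV UV]].
  have [n [bfs bU]] := bx _ _ fU; exists n => //.
  split=> // -[_ /= bgs]; apply: UV; exists (g s).
  by split; [exact: bU|exact: nbhs_singleton].
apply: measurableD => //; apply: bigcupT_measurable => n.
apply: measurableD; [apply: mf|apply: mg] => //; exact: sub_sigma_algebra.
Qed.

Lemma clopen_base_zero_dimensional (T : topologicalType) :
  has_clopen_base T -> accessible_space T -> zero_dimensional T.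
Proof.
move=> [B [_ Bx] Bclopen] aT x y /aT[U [oU [/set_mem xU /set_mem yU]]].
have [A [BA Ax] AU] : filter_from [set A | B A /\ A x] id U.
  by apply: Bx; apply: open_nbhs_nbhs; split.
exists A; split => //; first exact: Bclopen.
by move=> /AU.
Qed.

Lemma zero_dimensional_setX (S T : topologicalType) :
  zero_dimensional S -> zero_dimensional T -> zero_dimensional (S * T)%type.
Proof.
move=> zS zT [s t] [s' t']; have [<- stt'|ss' _] := eqVneq s s'.
  have /zT[U [cU Ut Ut']] : t != t' by apply: contraNneq stt' => ->.
  exists (snd @^-1` U); split => //.
  by apply: preimage_clopen => //; move=> ?; exact: cvg_snd.
have [U [cU Us Us']] := zS _ _ ss'; exists (fst @^-1` U); split => //.
by apply: preimage_clopen => //; move=> ?; exact: cvg_fst.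
Qed.

Lemma hausdorff_setX (S T : topologicalType) :
  hausdorff_space S -> hausdorff_space T -> hausdorff_space (S * T)%type.
Proof.
move=> hS hT [s t] [s' t'] stc.
have -> : s = s'.
  apply: hS => A B sA sB; have [] := stc (fst @^-1` A) (fst @^-1` B).
  - exact: cvg_fst.
  - exact: cvg_fst.
  by move=> z [? ?]; exists z.1.
have -> // : t = t'.
apply: hT => A B tA tB; have [] := stc (snd @^-1` A) (snd @^-1` B).
- exact: cvg_snd.
- exact: cvg_snd.
by move=> z [? ?]; exists z.2.
Qed.

Lemma clopen_seq (R : realType) (T : pseudoPMetricType R) : compact [set: T] ->
  exists c : nat -> set T, (forall n, clopen (c n)) /\
    (forall A, clopen A -> exists n, c n = A).
Proof.
move=> cT.
have [c [c0 cA]] := seq_of_countable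
  (clopen_countable cT (compact_second_countable cT)).
exists c; split => // n; have [->|//] := c0 n; exact: clopen0.
Qed.

(** Zero-dimensionality in the sense of separating points by clopen sets yields,
    in a compact Hausdorff space, a base of clopen sets. *)
Lemma open_bigcup_clopen (R : realType) (T : pseudoPMetricType R)
    (W : set T) :
  compact [set: T] -> hausdorff_space T -> zero_dimensional T -> open W ->
  exists c : nat -> set T, (forall n, clopen (c n)) /\ W = \bigcup_n c n.
Proof.
move=> cT hT zT oW; have [c [cc cA]] := clopen_seq cT.
exists (fun n => if pselect (c n `<=` W) then c n else set0); split.
  by move=> n; case: pselect => /= _ //; exact: clopen0.
rewrite eqEsubset; split=> [x Wx|x [n _]]; last by case: pselect => [cW /cW|_ []].
have [A [Ax cloA] AW] : filter_from [set D : set T | D x /\ clopen D] id W.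
  by apply: (zero_dimensional_cvg hT zT cT); exact: open_nbhs_nbhs.
have [n cn] := cA A cloA.
by exists n => //; case: pselect => //; rewrite cn.
Qed.

(** * Conditional probabilities and - t ln t *)

Lemma oppr_xlnx_ge0 (R : realType) (t : R) : 0 <= t <= 1 -> 0 <= - (t * ln t).
Proof. by move=> /andP[t0 t1]; rewrite -mulrN mulr_ge0// oppr_ge0 ln_le0. Qed.

(** By concavity, - t ln t lies below its tangent line at s. For s = 1 this
    bounds it by 1 - t. *)
Lemma oppr_xlnx_le (R : realType) (s t : R) : 0 < s -> 0 <= t ->
  - (t * ln t) <= - ln s * t + (s - t).
Proof.
move=> s0; rewrite le_eqVlt => /predU1P[<-|t0].
  by rewrite mul0r mulr0 oppr0 addr0 add0r ltW.
have := @le_ln1Dx R (s / t - 1).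
rewrite addrCA subrr addr0 ltrBrDr addNr divr_gt0// => /(_ isT).
rewrite ln_div ?posrE// -(ler_pM2l t0) !mulrBr mulr1 mulrCA mulfV ?gt_eqF//.
by rewrite mulr1; lra.
Qed.

Section cond_prob.
Context (R : realType) d (T : measurableType d) (mu : probability T R).
Implicit Types (f : T -> R) (A B E : set T).

Lemma gt0_integral_le0 B f : measurable B -> measurable_fun B f ->
  (forall x, B x -> 0 < f x) -> (\int[mu]_(x in B) (f x)%:E <= 0)%E -> mu B = 0%E.
Proof.
move=> mB mf f0 If.
have mEf : measurable_fun B (EFin \o f : T -> \bar R) by exact/measurable_EFinP.
have : (\int[mu]_(x in B) `|(f x)%:E| = 0)%E.
  apply/eqP; rewrite eq_le integral_ge0// andbT; apply: le_trans If.
  rewrite (@eq_integral _ _ _ _ _ (EFin \o f))// => x /set_mem/f0 fx0.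
  by rewrite /= ger0_norm// ltW.
move/(ae_eq_integral_abs mu mB mEf) => [N [mN N0 fN]].
apply: subset_measure0 N0 => // x Bx; apply: fN => /= /(_ Bx) [] fx.
by have := f0 _ Bx; rewrite fx ltxx.
Qed.

(* f is a version of the conditional probability of A given C on E. *)
Variables (E : set T) (C : set (set T)) (A : set T) (f : T -> R).
Hypotheses (mE : measurable E) (Cm : C `<=` measurable) (mA : measurable A).
Hypotheses (fC : preimage_set_system E f measurable `<=` C)
  (fint : mu.-integrable E (EFin \o f))
  (fA : forall B, C B -> (\int[mu]_(z in B) (f z)%:E = mu (A `&` B))%E).

Lemma cond_prob_ae01 : {ae mu, forall z, E z -> 0 <= f z <= 1}.
Proof.
have mf : measurable_fun E f by apply/measurable_EFinP; case/integrableP: fint.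
have CN1 : C (E `&` f @^-1` `]-oo, 0[) by apply: fC; exists `]-oo, 0[%classic.
have CN2 : C (E `&` f @^-1` `]1, +oo[) by apply: fC; exists `]1, +oo[%classic.
have int D : C D -> D `<=` E -> mu.-integrable D (EFin \o f).
  by move=> CD DE; apply: integrableS fint => //; exact: Cm.
have N10 : mu (E `&` f @^-1` `]-oo, 0[) = 0%E.
  apply: (@gt0_integral_le0 _ (fun x => - f x)); first exact: Cm.
  - by apply: measurableT_comp => //; apply: measurable_funS mf.
  - by move=> x [_ /=]; rewrite in_itv/= oppr_gt0.
  under eq_integral do rewrite EFinN.
  rewrite integralN/=; last first.
    by apply: integrable_add_def; [exact: Cm|apply: (int _ CN1) => x []].
  by rewrite fA// oppe_le0 measure_ge0.
have N20 : mu (E `&` f @^-1` `]1, +oo[) = 0%E.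
  apply: (@gt0_integral_le0 _ (fun x => f x - 1)); first exact: Cm.
  - by apply: measurable_funB => //; apply: measurable_funS mf.
  - by move=> x [_ /=]; rewrite in_itv/= andbT subr_gt0.
  under eq_integral do rewrite EFinB.
  rewrite integralB_EFin//; first last.
  - exact: finite_measure_integrable_cst (Cm CN2).
  - by apply: int => // x [].
  - exact: Cm.
  rewrite fA//= integral_cst; last exact: Cm.
  rewrite mul1e sube_le0 le_measure// inE; last exact: Cm.
  by apply: measurableI => //; exact: Cm.
exists ((E `&` f @^-1` `]-oo, 0[) `|` (E `&` f @^-1` `]1, +oo[)); split.
- by apply: measurableU; exact: Cm.
- apply/eqP; rewrite -measure_le0 (le_trans (measureU2 _ (Cm CN1) (Cm CN2)))//.
  by rewrite [X in (X + _)%E]N10 [X in (_ + X)%E]N20 adde0.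
move=> z /= /not_implyP[Ez]; rewrite !in_itv/= andbT.
move=> /negP; rewrite negb_and -!ltNge => /orP[]; by [left|right].
Qed.

(** When B belongs to C and nearly equals A, the A-term of the conditional entropy
    given C is small: on B the conditional probability f is close to 1 on
    average and - f ln f is at most 1 - f, while on E \ B it is close to 0 on
    average and - f ln f is below the tangent line at s. No monotonicity of
    entropy in C is required. *)
Lemma cond_prob_entropy_bounds B (s : R) : C B -> C (E `\` B) -> B `<=` E ->
  0 < s < 1 ->
  (0 <= - (\int[mu]_(z in E) (f z * ln (f z))%:E) <=
    mu (B `\` A) + (- ln s)%:E * mu (A `\` B) + s%:E)%E.
Proof.
move=> CB CEB BE /andP[s0 s1].
have mf : measurable_fun E f by apply/measurable_EFinP; case/integrableP: fint.
(* g is f truncated to [0, 1]; both agree almost everywhere on E *)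
pose g z := Num.max 0 (Num.min 1 (f z)).
have mg : measurable_fun E g.
  by apply: measurable_maxr => //; exact: measurable_minr.
have g01 z : 0 <= g z <= 1.
  by rewrite /g le_max lexx/= ge_max ler01 ge_min lexx.
have fg : ae_eq mu E f g.
  apply: filterS cond_prob_ae01 => z + Ez => /(_ Ez)/andP[f0 f1].
  by rewrite /g (min_r f1) (max_r f0).
have gA D : C D -> D `<=` E -> (\int[mu]_(z in D) (g z)%:E = mu (A `&` D))%E.
  move=> CD DE; rewrite -fA//; apply: ae_eq_integral; first exact: Cm.
  - by apply/measurable_EFinP; exact: measurable_funS mg.
  - by apply/measurable_EFinP; exact: measurable_funS mf.
  by apply: filterS fg => z + /DE => /[apply] /= ->.
pose phi z := - (g z * ln (g z)).
have mlng : measurable_fun E (fun z => g z * ln (g z)).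
  by apply: measurable_funM => //; exact: measurableT_comp.
have mphi : measurable_fun E phi by exact: measurableT_comp.
have phi0 z : 0 <= phi z by exact: oppr_xlnx_ge0.
have -> : (- (\int[mu]_(z in E) (f z * ln (f z))%:E) = \int[mu]_(z in E) (phi z)%:E)%E.
  rewrite (@ae_eq_integral _ _ _ mu E (fun z => (g z * ln (g z))%:E))//; first last.
  - by apply: filterS fg => z + Ez => /(_ Ez) ->.
  - exact/measurable_EFinP.
  - apply/measurable_EFinP; apply: measurable_funM => //.
    by apply: measurableT_comp => //; exact: measurable_ln.
  under eq_integral do rewrite -[_ * _]opprK EFinN.
  rewrite integral_ge0N; last by move=> z _; rewrite lee_fin; exact: phi0.
  by rewrite oppeK.
rewrite integral_ge0/=; last by move=> z _; rewrite lee_fin.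
have mB : measurable B by exact: Cm.
have mEB : measurable (E `\` B) by exact: Cm.
rewrite -{1}(setDUK BE) ge0_integral_setU//; last 3 first.
- by rewrite setDUK//; exact/measurable_EFinP.
- by move=> z _; rewrite lee_fin.
- by apply/disj_setPS => z [Bz []].
have mS D (h : T -> R) : measurable_fun E h -> D `<=` E -> measurable D ->
    measurable_fun D (EFin \o h : T -> \bar R).
  by move=> mh DE mD; apply/measurable_EFinP; exact: measurable_funS mh.
rewrite -[leRHS]addeA; apply: leeD.
  have : ((\int[mu]_(z in B) (phi z)%:E) + mu (A `&` B) <=
      mu (B `\` A) + mu (A `&` B))%E.
    rewrite -[X in (_ + X <= _)%E]gA// -ge0_integralD//; first last.
    - by apply: mS.
    - by move=> z _; rewrite lee_fin; case/andP: (g01 z).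
    - by apply: mS.
    - by move=> z _; rewrite lee_fin.
    apply: (@le_trans _ _ (\int[mu]_(z in B) (cst 1%E z))%E).
      apply: ge0_le_integral => //.
      - by move=> z _; rewrite adde_ge0// lee_fin//; case/andP: (g01 z).
      - by apply: emeasurable_funD; exact: mS.
      move=> z _; rewrite -EFinD lee_fin.
      have := @oppr_xlnx_le R 1 (g z) ltr01; rewrite ln1 oppr0 mul0r add0r.
      by case/andP: (g01 z) => g0 _ /(_ g0); rewrite /phi; lra.
    rewrite integral_cst// mul1e -[X in (mu X <= _)%E](setDUK (@subIsetr _ A B)).
    rewrite setDIr setDv setU0 measureU//; first by rewrite addeC.
    - exact: measurableI.
    - exact: measurableD.
    by apply/seteqP; split => // z [[]] + + [].
  by rewrite leeD2rE; [|apply: fin_num_measure; exact: measurableI].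
have ls : 0 <= - ln s by rewrite oppr_ge0 ln_le0// ltW.
apply: (@le_trans _ _ (\int[mu]_(z in E `\` B) ((- ln s)%:E * (g z)%:E + s%:E))%E).
  apply: ge0_le_integral => //.
  - by move=> z _; rewrite lee_fin.
  - by apply: mS => // z [].
  - apply: emeasurable_funD => //; apply: emeasurable_funM => //.
    by apply: mS => // z [].
  move=> z _; rewrite -EFinM -EFinD lee_fin; case/andP: (g01 z) => g0 _.
  by apply: le_trans (oppr_xlnx_le s0 g0) _; rewrite lerD2l lerBlDr lerDl.
have mgEB : measurable_fun (E `\` B) (EFin \o g : T -> \bar R).
  by apply: mS => // z [].
rewrite ge0_integralD//; first last.
- by move=> z _; rewrite lee_fin ltW.
- by apply: emeasurable_funM.
- by move=> z _; rewrite mule_ge0// lee_fin//; case/andP: (g01 z).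
rewrite ge0_integralZl//; last by move=> z _; rewrite lee_fin; case/andP: (g01 z).
rewrite gA//.
apply: leeD.
  apply: lee_wpmul2l; first by rewrite lee_fin.
  apply: le_measure; rewrite ?inE; [exact: measurableI|exact: measurableD|].
  by move=> z [? []].
rewrite integral_cst//= -[leRHS]mule1; apply: lee_wpmul2l.
  by rewrite lee_fin ltW.
exact: probability_le1.
Qed.

End cond_prob.

(** * Approximation by an algebra of sets *)

Section approximation.
Context (R : realType) d (T : measurableType d) (mu : probability T R).
Implicit Types (A B : set T) (AA : set (set T)).

(** Finite unions exhaust a countable union up to small measure. *)
Lemma bigcup_tail_small (F : nat -> set T) (e : R) :
  (forall n, measurable (F n)) -> 0 < e ->
  exists n, (mu ((\bigcup_k F k) `\` \bigcup_(k < n) F k) <= e%:E)%E.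
Proof.
move=> mF e0; pose G n := (\bigcup_k F k) `\` \bigcup_(k < n) F k.
have mU : measurable (\bigcup_k F k) by exact: bigcupT_measurable.
have mUn n : measurable (\bigcup_(k < n) F k) by exact: bigcup_measurable.
have mG n : measurable (G n) by exact: measurableD.
have G0 : \bigcap_n G n = set0.
  rewrite -subset0 => x Gx; have [[k _ Fkx] _] := Gx 0%N I.
  by have [_] := Gx k.+1 I; apply; exists k => //=.
have : mu \o G @ \oo --> mu (\bigcap_n G n).
  apply: nonincreasing_cvg_mu => //.
  - by rewrite ltey_eq fin_num_measure.
  - exact: bigcapT_measurable.
  move=> m n mn; apply/subsetPset => x [Ux nFx]; split => //.
  by apply: contra_not nFx => -[k /= km Fkx]; exists k => //=; exact: leq_trans mn.
rewrite G0 measure0 => /fine_cvgP[_ /cvgrPdist_le/(_ _ e0)[n _ /(_ n (leqnn n))]].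
rewrite /= sub0r normrN => Gn; exists n.
have fG : mu (G n) \is a fin_num by exact: fin_num_measure.
rewrite -/(G n) -(fineK fG) lee_fin; apply: le_trans Gn.
exact: ler_norm.
Qed.

Lemma measure_bigcup_ord_le (N : nat) (F : 'I_N -> set T) (e : R) :
  (forall i, measurable (F i)) -> (forall i, (mu (F i) <= e%:E)%E) ->
  (mu (\bigcup_i F i) <= (e *+ N)%:E)%E.
Proof.
move=> mF Fe.
have -> : \bigcup_i F i = \big[setU/set0]_(i < N) F i.
  rewrite -(bigcup_seq _ F)/=; apply: eq_bigcupl; split => // i _ /=.
  by rewrite mem_index_enum.
suff : (mu (\big[setU/set0]_(i < N) F i) <= \sum_(i < N) e%:E)%E.
  by rewrite sumEFin sumr_const card_ord.
have [] : measurable (\big[setU/set0]_(i < N) F i) /\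
    (mu (\big[setU/set0]_(i < N) F i) <= \sum_(i < N) e%:E)%E; last by [].
elim/big_ind2 : _ => //.
- by rewrite measure0; split.
- move=> A x B y [mA Ax] [mB By]; split; first exact: measurableU.
  by apply: le_trans (measureU2 _ mA mB) _; exact: leeD.
Qed.

(** B is measurable and, for every e > 0, differs from some member of AA by a set
    of measure at most e. *)
Definition approximable AA B := measurable B /\
  forall e : R, 0 < e -> exists2 A, AA A & (mu (B `+` A) <= e%:E)%E.

Variables (AA : set (set T)) (mAA : AA `<=` measurable)
  (AA0 : AA set0) (AAC : setC_closed AA) (AAU : setU_closed AA).

Lemma approximable_id : AA `<=` approximable AA.
Proof.
move=> A AAA; split; first exact: mAA.
by move=> e e0; exists A => //; rewrite setYK measure0 lee_fin ltW.
Qed.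

Lemma approximable_subset B : measurable B ->
  (forall e : R, 0 < e -> exists B', [/\ approximable AA B', B' `<=` B &
     (mu (B `\` B') <= e%:E)%E]) -> approximable AA B.
Proof.
move=> mB BB'; split => // e e0.
have e20 : 0 < e / 2 by rewrite divr_gt0.
have [B' [[mB' /(_ _ e20)[A AAA B'A]] B'B BB'e]] := BB' _ e20.
exists A => //; have mA := mAA AAA.
have mBB' : measurable (B `\` B') by exact: measurableD.
have mB'A : measurable (B' `+` A) by apply: measurableU; exact: measurableD.
apply: (@le_trans _ _ (mu ((B `\` B') `|` (B' `+` A)))).
  apply: le_measure; rewrite ?inE; first by apply: measurableU; exact: measurableD.
    exact: measurableU.
  move=> x [[Bx nAx]|[Ax nBx]]; last by right; right; split => // /B'B.
  have [B'x|nB'x] := pselect (B' x); last by left.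
  by right; left.
rewrite (le_trans (measureU2 _ _ _))// [e]splitr EFinD; exact: leeD.
Qed.

Lemma approximableU A B : approximable AA A -> approximable AA B ->
  approximable AA (A `|` B).
Proof.
move=> [mA AAA] [mB AAB]; split; first exact: measurableU.
move=> e e0; have e20 : 0 < e / 2 by rewrite divr_gt0.
have [A' AAA' AA'] := AAA _ e20; have [B' AAB' BB'] := AAB _ e20.
exists (A' `|` B'); first exact: AAU.
have mA' := mAA AAA'; have mB' := mAA AAB'.
have mY (C C' : set T) : measurable C -> measurable C' -> measurable (C `+` C').
  by move=> mC mC'; apply: measurableU; exact: measurableD.
apply: (@le_trans _ _ (mu ((A `+` A') `|` (B `+` B')))).
  apply: le_measure; rewrite ?inE.
  - by apply: mY; exact: measurableU.
  - by apply: measurableU; exact: mY.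
  move=> x [[[Ax|Bx]] /not_orP[nA'x nB'x]|[[A'x|B'x]] /not_orP[nAx nBx]].
  - by left; left.
  - by right; left.
  - by left; right.
  - by right; right.
rewrite (le_trans (measureU2 _ _ _))//; [exact: mY|exact: mY|].
by rewrite [e]splitr EFinD; exact: leeD.
Qed.

(** The sets approximable by an algebra AA of measurable sets form a
    sigma-algebra. *)
Lemma approximable_sigma : sigma_algebra setT (approximable AA).
Proof.
split.
- exact: approximable_id.
- move=> B [mB BA]; rewrite setTD; split; first exact: measurableC.
  move=> e /BA[A AAA BAe]; exists (~` A); first exact: AAC.
  rewrite /setY !setDE !setCK [X in mu (X `|` _)]setIC.
  by rewrite [X in mu (_ `|` X)]setIC setUC -!setDE.
move=> F aF; have mF n : measurable (F n) by case: (aF n).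
apply: approximable_subset; first exact: bigcupT_measurable.
move=> e e0; have [n Fn] := bigcup_tail_small mF e0.
exists (\bigcup_(k < n) F k); split => //; last by move=> x [k _ Fkx]; exists k.
rewrite bigcup_mkord; apply: big_ind => //; first exact: approximable_id.
exact: approximableU.
Qed.

End approximation.

(** * Clopen partitions *)

(* This makes products pointed pseudometric spaces, as the counting of clopen
   sets requires. *)
HB.instance Definition _ (R : realType) (S T : pseudoPMetricType R) :=
  Pointed.on (S * T)%type.

Section clopen_partitions.
Context (T : topologicalType) (N : nat).
Implicit Types (U V W Q : 'I_N -> set T).

(** W is a partition of the whole space into clopen sets, indexed like U and with
    W i inside U i for every i; members may be empty. *)
Definition clopen_partition U W := [/\ forall i, clopen (W i),
  \bigcup_i W i = [set: T], trivIset [set: 'I_N] W & forall i, W i `<=` U i].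

(** Q i deprived of the earlier members of Q *)
Definition disjointify Q (i : 'I_N) : set T :=
  Q i `\` \bigcup_(j in [set j : 'I_N | (j < i)%N]) Q j.

Lemma clopen_bigcup_ord Q (P : set 'I_N) : (forall i, clopen (Q i)) ->
  clopen (\bigcup_(i in P) Q i).
Proof.
move=> cQ; split; first by apply: bigcup_open => i _; case: (cQ i).
by apply: closed_bigcup => [|i _]; [exact: finite_finset|case: (cQ i)].
Qed.

Lemma clopenD (A B : set T) : clopen A -> clopen B -> clopen (A `\` B).
Proof. by move=> cA cB; rewrite setDE; apply: clopenI => //; exact: clopenC. Qed.

Lemma clopen_disjointify Q i : (forall i, clopen (Q i)) -> clopen (disjointify Q i).
Proof. by move=> cQ; apply: clopenD => //; exact: clopen_bigcup_ord. Qed.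

Lemma trivIset_disjointify Q : trivIset [set: 'I_N] (disjointify Q).
Proof.
move=> i j _ _ [x [[Qi nQi] [Qj nQj]]].
have [ij|ji|/val_inj//] := ltngtP i j.
- by exfalso; apply: nQj; exists i.
- by exfalso; apply: nQi; exists j.
Qed.

Lemma bigcup_disjointify Q : \bigcup_i disjointify Q i = \bigcup_i Q i.
Proof.
rewrite eqEsubset; split=> [x [i _ []]|x [i _ Qix]]; first by exists i.
have ex : exists n, `[< exists2 j : 'I_N, val j = n & Q j x >].
  by exists i; apply/asboolP; exists i.
case: (ex_minnP ex) => n /asboolP[j jn Qjx] nmin; exists j => //; split => //.
move=> [k /= kj Qkx]; have := nmin k; rewrite -jn leqNgt kj => /(_ _)/notF; apply.
by apply/asboolP; exists k.
Qed.

(** Any clopen family Q subordinate to U can be turned into a clopen partition W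
    subordinate to U which agrees with Q at the points covered exactly once by
    Q: the members of Q are made disjoint, and what they leave uncovered is
    distributed along V. *)
Lemma merge_partition U V Q : clopen_partition U V ->
  (forall i, clopen (Q i)) -> (forall i, Q i `<=` U i) ->
  exists2 W, clopen_partition U W & forall x k, Q k x ->
    (forall j, Q j x -> j = k) -> forall i, W i x <-> i = k.
Proof.
move=> [cV VT tV VU] cQ QU.
pose W i := disjointify Q i `|` (V i `\` \bigcup_j Q j).
have tW : trivIset [set: 'I_N] W.
  move=> i j _ _ [x [[Di|[Vi nQ]] [Dj|[Vj nQ']]]].
  - by apply: (@trivIset_disjointify Q) => //; exists x.
  - by exfalso; apply: nQ'; exists i => //; case: Di.
  - by exfalso; apply: nQ; exists j => //; case: Dj.
  - by apply: tV => //; exists x.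
exists W.
  split => //.
  - move=> i; apply: clopenU; first exact: clopen_disjointify.
    by apply: clopenD => //; exact: clopen_bigcup_ord.
  - rewrite -subTset => x _; have [|nQ] := pselect ((\bigcup_j Q j) x).
      by rewrite -bigcup_disjointify => -[i _ Di]; exists i => //; left.
    have : (\bigcup_i V i) x by rewrite VT.
    by move=> [i _ Vi]; exists i => //; right.
  by move=> i x [[/QU//]|[/VU]].
move=> x k Qk kuniq i; have Wk : W k x.
  by left; split => // -[j /= jk /kuniq jk']; rewrite jk' ltnn in jk.
by split=> [Wi|->//]; apply: tW => //; exists x.
Qed.

End clopen_partitions.

Lemma clopen_partition_exists (R : realType) (T : pseudoPMetricType R) N
    (U : 'I_N -> set T) :
  compact [set: T] -> hausdorff_space T -> zero_dimensional T ->
  (forall i, open (U i)) -> \bigcup_i U i = [set: T] ->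
  exists V, clopen_partition U V.
Proof.
move=> cT hT zT oU UT.
have /choice[c cU] : forall i, exists c : nat -> set T,
    (forall n, clopen (c n)) /\ U i = \bigcup_n c n.
  by move=> i; exact: open_bigcup_clopen.
pose Q n i := \bigcup_(k < n) c i k.
have cQ n i : clopen (Q n i).
  rewrite /Q bigcup_mkord; apply: big_ind; [exact: clopen0|exact: clopenU|].
  by move=> k _; case: (cU i).
have [D _ TD] : finite_subset_cover setT (fun n => \bigcup_i Q n i) [set: T].
  move: cT; rewrite compact_cover; apply.
    by move=> n _; apply: bigcup_open => i _; case: (cQ n i).
  move=> x _; have : (\bigcup_i U i) x by rewrite UT.
  move=> [i _]; rewrite (cU i).2 => -[k _ cik].
  by exists k.+1 => //; exists i => //; exists k => /=.
pose m := (\max_(n <- D) n)%N.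
have QT : \bigcup_i Q m i = [set: T].
  rewrite -subTset => x /TD[n /= nD [i _ [k /= kn cik]]].
  exists i => //; exists k => //=; apply: leq_trans kn _.
  exact: (@leq_bigmax_seq _ _ _ (fun n => n)).
exists (disjointify (Q m)); split.
- by move=> i; exact: clopen_disjointify.
- by rewrite bigcup_disjointify.
- exact: trivIset_disjointify.
- by move=> i x [[k _ cik] _]; rewrite (cU i).2; exists k.
Qed.

(** All clopen partitions subordinate to U can be listed in one sequence, since
    there are countably many clopen sets. *)
Lemma clopen_partition_seq (R : realType) (T : pseudoPMetricType R) N
    (U : 'I_N -> set T) :
  compact [set: T] -> hausdorff_space T -> zero_dimensional T ->
  (forall i, open (U i)) -> \bigcup_i U i = [set: T] ->
  exists W : nat -> 'I_N -> set T, (forall n, clopen_partition U (W n)) /\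
    forall V, clopen_partition U V -> exists n, W n = V.
Proof.
move=> cT hT zT oU UT; have [V0 V0U] := clopen_partition_exists cT hT zT oU UT.
have [c [_ cA]] := clopen_seq cT.
pose W n := if choice.unpickle n is Some t
  then fun i => c ((t : {ffun 'I_N -> nat}) i) else V0.
exists (fun n => if pselect (clopen_partition U (W n)) then W n else V0); split.
  by move=> n; case: pselect.
move=> V VU; have /choice[t ct] : forall i, exists k, c k = V i.
  by move=> i; apply: cA; case: VU.
have WV : W (choice.pickle (finfun t)) = V.
  by apply/funext => i; rewrite /W choice.pickleK ffunE ct.
by exists (choice.pickle (finfun t)); rewrite WV; case: pselect.
Qed.

Section product_approximation.
Context (R : realType) d (Omega : measurableMetricType R d)
  (P : probability Omega R) (X : pmetricType R)
  (mu : probability (Omega * borel X)%type R).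
Hypotheses (Omega_compact : compact [set: Omega]) (X_compact : compact [set: X])
  (Omega_zero_dim : zero_dimensional Omega) (X_zero_dim : zero_dimensional X)
  (Omega_borel : is_completion_of P (@open Omega))
  (muP : forall A : set Omega, measurable A -> mu (A `*` [set: X]) = P A).

Lemma prod_compact : compact [set: Omega * X].
Proof. by rewrite -setXTT; exact: compact_setX. Qed.

Lemma prod_hausdorff : hausdorff_space (Omega * X)%type.
Proof. by apply: hausdorff_setX; exact: metric_hausdorff. Qed.

Lemma prod_zero_dim : zero_dimensional (Omega * X)%type.
Proof. exact: zero_dimensional_setX. Qed.

Lemma open_measurable : @open Omega `<=` measurable.
Proof. by move=> A oA; case: Omega_borel => + _; apply; exact: sub_sigma_algebra. Qed.

(* The clopen sets of the topological product, as sets of the measurable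
   product. *)
Let clo : set (set (Omega * borel X)) := @clopen (Omega * X)%type.

Lemma clopen_measurable : clo `<=` measurable.
Proof.
move=> W [oW _]; apply: open_prod_measurable => //; exact: open_measurable.
Qed.

(** The clopen sets are dense in the measure algebra of mu. For the sets
    coming from Omega, the null sets added by the completion are discarded thanks
    to the marginal of mu. *)
Lemma approximable_clopen (B : set (Omega * borel X)) : measurable B ->
  approximable mu clo B.
Proof.
have clo0 : clo set0 by exact: clopen0.
have cloC : setC_closed clo by move=> A; exact: clopenC.
have cloU : setU_closed clo by exact: clopenU.
have sig := approximable_sigma mu clopen_measurable clo0 cloC cloU.
have ao (W : set (Omega * X)) : open W -> approximable mu clo W.
  move=> oW; have [c [cc ->]] :=
    open_bigcup_clopen prod_compact prod_hausdorff prod_zero_dim oW.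
  case: sig => _ _; apply => n; apply: approximable_id (cc n).
  exact: clopen_measurable.
have aO (A : set Omega) : <<s @open Omega >> A -> approximable mu clo (fst @^-1` A).
  rewrite -[_ @^-1` _]setTI; move: A; apply: smallest_sub.
    exact: (sigma_algebra_image _ sig).
  move=> A oA; rewrite /image_set_system/= setTI; apply: ao.
  by apply: open_comp => // ? _; exact: cvg_fst.
have aX (A : set X) : <<s @open X >> A -> approximable mu clo (snd @^-1` A).
  rewrite -[_ @^-1` _]setTI; move: A; apply: smallest_sub.
    exact: (sigma_algebra_image _ sig).
  move=> A oA; rewrite /image_set_system/= setTI; apply: ao.
  by apply: open_comp => // ? _; exact: cvg_snd.
move: B; apply: smallest_sub => //; rewrite subUset; split.
  move=> _ [A mA <-]; rewrite setTI.
  have [A1 [A2 [sA1 sA2 A1A AA2 PA]]] := (Omega_borel.2 A).1 mA.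
  have mA12 : measurable (A2 `\` A1).
    by apply: measurableD; exact: Omega_borel.1.
  apply: approximable_subset; first exact: clopen_measurable.
    by rewrite -[_ @^-1` _]setTI; exact: measurable_fst.
  move=> e e0; exists (fst @^-1` A1); split; [exact: aO|exact: preimage_subset|].
  apply: (@le_trans _ _ (mu ((A2 `\` A1) `*` [set: X]))).
    apply: le_measure; rewrite ?inE.
    - apply: measurableD; rewrite -[_ @^-1` _]setTI; apply: measurable_fst => //.
      exact: Omega_borel.1.
    - exact: measurableX.
    by move=> z [/= /AA2 ? ?].
  by rewrite muP// PA lee_fin ltW.
by move=> _ [A mA <-]; rewrite setTI; exact: aX.
Qed.

(** A measurable partition of E subordinate to an open cover U is approximated by
    the traces of clopen partitions which are themselves subordinate to U. *)
Lemma clopen_partition_approximation N (U beta : 'I_N -> set (Omega * X))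
    (E : set (Omega * X)) (e : R) :
  (forall i, open (U i)) -> \bigcup_i U i = [set: Omega * X] ->
  (forall i, measurable (beta i : set (Omega * borel X))) ->
  measurable (E : set (Omega * borel X)) ->
  \bigcup_i beta i = E -> trivIset [set: 'I_N] beta ->
  (forall i, beta i `<=` U i) -> 0 < e ->
  exists2 W, clopen_partition U W & forall i,
    (mu (beta i `\` W i) <= e%:E)%E /\ (mu ((W i `&` E) `\` beta i) <= e%:E)%E.
Proof.
move=> oU UT mbeta mE betaE tbeta betaU e0.
pose e' := e / 2 / N.+1%:R.
have e'0 : 0 < e' by rewrite !divr_gt0.
have /choice[A Abeta] : forall i, exists A : set (Omega * X),
    clopen A /\ (mu (beta i `+` A) <= e'%:E)%E.
  by move=> i; have [_ /(_ _ e'0)[A ? ?]] := approximable_clopen (mbeta i); exists A.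
have /choice[C CU] : forall i, exists C : set (Omega * X),
    [/\ clopen C, C `<=` U i & (mu (U i `\` C) <= e'%:E)%E].
  move=> i; have [c [cc Uc]] :=
    open_bigcup_clopen prod_compact prod_hausdorff prod_zero_dim (oU i).
  have mc n : measurable (c n : set (Omega * borel X)).
    exact: (clopen_measurable (cc n)).
  have [n cn] := bigcup_tail_small mu mc e'0.
  exists (\bigcup_(k < n) c k); split; last by rewrite Uc.
    rewrite bigcup_mkord; apply: big_ind; [exact: clopen0|exact: clopenU|] => *.
    exact: cc.
  by rewrite Uc => x [k _ ck]; exists k.
have [V VU] :=
  clopen_partition_exists prod_compact prod_hausdorff prod_zero_dim oU UT.
(* A i approximates beta i, C i exhausts U i: Q i approximates beta i from
   within U i *)
pose Q i := A i `&` C i.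
have cQ i : clopen (Q i).
  by apply: clopenI; [case: (Abeta i)|case: (CU i)].
have QU i : Q i `<=` U i by move=> x [_]; case: (CU i) => _ + _; apply.
have [W WU WQ] := merge_partition VU cQ QU.
exists W => //.
have mA i : measurable (A i : set (Omega * borel X)).
  by have [cA _] := Abeta i; exact: (clopen_measurable cA).
have mC i : measurable (C i : set (Omega * borel X)).
  by have [cC _ _] := CU i; exact: (clopen_measurable cC).
have mU i : measurable (U i : set (Omega * borel X)).
  by apply: open_prod_measurable => //; exact: open_measurable.
have mW i : measurable (W i : set (Omega * borel X)).
  by case: WU => /(_ i) cW _ _ _; exact: (clopen_measurable cW).
pose Z (i : 'I_N) : set (Omega * borel X) := (beta i `+` A i) `|` (U i `\` C i).
have mZ i : measurable (Z i).
  apply: measurableU; last exact: measurableD.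
  by apply: measurableU; exact: measurableD.
have Ze i : (mu (Z i) <= (e' + e')%:E)%E.
  rewrite (le_trans (measureU2 _ _ _))//.
  - by apply: measurableU; exact: measurableD.
  - exact: measurableD.
  by rewrite EFinD; apply: leeD; [case: (Abeta i)|case: (CU i)].
have mUZ : measurable (\bigcup_i Z i).
  by apply: fin_bigcup_measurable => //; exact: finite_finset.
have UZe : (mu (\bigcup_i Z i) <= e%:E)%E.
  apply: le_trans (measure_bigcup_ord_le mZ Ze) _; rewrite lee_fin.
  have -> : e = (e' + e') *+ N.+1.
    by rewrite /e' -mulrDl -splitr -[RHS]mulr_natr mulfVK// pnatr_eq0.
  by rewrite ler_wpMn2l// addr_ge0// ltW.
(* away from the exceptional sets Z i, the sets Q i cut E exactly as beta does *)
have agree z : E z -> ~ (\bigcup_i Z i) z -> forall i, W i z <-> beta i z.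
  move=> Ez nZ; have QB i : Q i z <-> beta i z.
    have nZi : ~ Z i z by move=> Zi; apply: nZ; exists i.
    split=> [[Ai _]|bi].
      by apply: contrapT => nb; apply: nZi; left; right.
    split; first by apply: contrapT => nA; apply: nZi; left; left.
    by apply: contrapT => nC; apply: nZi; right; split => //; exact: betaU.
  move: Ez; rewrite -betaE => -[k _ bk] i.
  rewrite (WQ z k) ?QB//; last first.
    by move=> j /QB bj; apply: tbeta => //; exists z.
  by split=> [->//|bi]; apply: tbeta => //; exists z.
move=> i; split; apply: le_trans UZe; apply: le_measure; rewrite ?inE//.
- exact: measurableD.
- move=> z [bi nWi]; apply: contrapT => nZ; apply: nWi.
  by apply/agree => //; rewrite -betaE; exists i.
- by apply: measurableD => //; exact: measurableI.
- move=> z [[Wi Ez] nbi]; apply: contrapT => nZ; apply: nbi.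
  exact/agree.
Qed.

End product_approximation.

(** * Excellence over zero-dimensional state spaces *)

Lemma continuous_xsection (S T : topologicalType) (s : S) :
  continuous (fun t : T => (s, t)).
Proof. by move=> t; apply: cvg_pair => //; exact: cvg_cst. Qed.

Lemma open_xsectionI (S T : topologicalType) (W E : set (S * T)) (s : S) :
  open W -> open (xsection (W `&` E) s : set (subspace (xsection E s))).
Proof.
move=> oW; apply/open_subspaceP; exists (xsection W s).
  by rewrite xsectionE; apply: open_comp => // ? _; exact: continuous_xsection.
by rewrite xsectionI -setIA setIid.
Qed.

Lemma clopen_xsectionI (S T : topologicalType) (W E : set (S * T)) (s : S) :
  clopen W -> clopen (xsection (W `&` E) s : set (subspace (xsection E s))).
Proof.
move=> [oW cW]; split; first exact: open_xsectionI.
apply/closed_subspaceP; exists (xsection W s).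
  by rewrite xsectionE; apply: preimage_closed => // ? _; exact: continuous_xsection.
by rewrite xsectionI -setIA setIid.
Qed.

Section excellent_zero_dimensional.
Context (R : realType) d (Omega : measurableMetricType R d)
  (P : probability Omega R) (X : pmetricType R) (E : set (Omega * X)) (N : nat).
Hypothesis mE : measurable (E : set (Omega * borel X)).
Implicit Types (mu : probability (Omega * borel X)%type R)
  (A B : 'I_N -> set (Omega * X)).

Lemma join_sigma_measurable B :
  (forall i, measurable (B i : set (Omega * borel X))) ->
  join_sigma E B (base_sigma E) `<=` (measurable : set (set (Omega * borel X))).
Proof.
move=> mB; apply: smallest_sub.
  split; first exact: measurable0.
  - by move=> A mA; exact: measurableD.
  - by move=> F mF; exact: bigcupT_measurable.
move=> _ [[i _ <-]//|[A mA <-]]; apply: measurableI => //.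
exact: (measurableX mA (measurableT : measurable [set: borel X])).
Qed.

(** Two partitions which nearly coincide have small entropy conditionally on each
    other. When no conditional probability exists, [cond_prob] is the zero
    function, whose contribution is 0. *)
Lemma cond_entropy_bounds mu A B (e s : R) :
  (forall i, measurable (A i : set (Omega * borel X))) ->
  (forall i, measurable (B i : set (Omega * borel X))) ->
  (forall i, B i `<=` E) ->
  (forall i, mu (B i `\` A i) <= e%:E)%E ->
  (forall i, mu (A i `\` B i) <= e%:E)%E -> 0 < s < 1 ->
  (0 <= cond_entropy mu E A (join_sigma E B (base_sigma E)) <=
    ((e + - ln s * e + s) *+ N)%:E)%E.
Proof.
move=> mA mB BE BA AB s01; set C := join_sigma _ _ _.
have Cm : C `<=` (measurable : set (set (Omega * borel X))).
  exact: join_sigma_measurable.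
have CB i : C (B i) by apply: sub_sigma_algebra; left; exists i.
have CEB i : C (E `\` B i) by exact: (sigma_algebraCD (CB i)).
set I := fun i => (\int[mu]_(z in E)
  (cond_prob mu E C (A i) z * ln (cond_prob mu E C (A i) z))%:E)%E.
have ls : 0 <= - ln s by rewrite oppr_ge0 ln_le0//; case/andP: s01 => _ /ltW.
have s0 : 0 < s by case/andP: s01.
have Ibounds i : (0 <= - I i <= (e + - ln s * e + s)%:E)%E.
  have e0 : 0 <= e by rewrite -lee_fin; apply: le_trans (BA i); exact: measure_ge0.
  rewrite /I /cond_prob; case: xgetP => [f _ [fC fint fA]|_].
    have /andP[I0 Ie] := cond_prob_entropy_bounds mE Cm (mA i) fC fint fA
      (CB i) (CEB i) (BE i) s01.
    rewrite I0/=; apply: le_trans Ie _; rewrite !EFinD EFinM.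
    apply: leeD => //; apply: leeD => //; exact: lee_wpmul2l.
  rewrite /cst integral0_eq; last by move=> z _; rewrite mul0r.
  by rewrite oppe0 lexx lee_fin/= !addr_ge0 ?mulr_ge0// ltW.
have fI i : I i \is a fin_num.
  rewrite -fin_numN ge0_fin_numE; last by case/andP: (Ibounds i).
  by case/andP: (Ibounds i) => _ Ie; exact: le_lt_trans Ie (ltry _).
have {}Ibounds i : 0 <= - fine (I i) <= e + - ln s * e + s.
  by rewrite -!lee_fin EFinN fineK.
rewrite /cond_entropy (eq_bigr (fun i => (fine (I i))%:E)); last first.
  by move=> i _; rewrite fineK.
rewrite sumEFin -EFinN !lee_fin -sumrN; apply/andP; split.
  by apply: sumr_ge0 => i _; case/andP: (Ibounds i).
rewrite -[in leRHS](card_ord N) -sumr_const; apply: ler_sum => i _.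
by case/andP: (Ibounds i).
Qed.

Hypotheses (Omega_compact : compact [set: Omega]) (X_compact : compact [set: X])
  (Omega_zero_dim : zero_dimensional Omega) (X_zero_dim : zero_dimensional X)
  (Omega_borel : is_completion_of P (@open Omega)).
Variables (U : 'I_N -> set (Omega * X)).
Hypotheses (U_open : forall i, open (U i))
  (U_cover : \bigcup_i U i = [set: Omega * X]).

(** Over a compact zero-dimensional state space, every cover of E by traces of
    open sets of Omega * X is excellent. *)
Lemma zero_dimensional_excellent : excellent P E (fun i => U i `&` E).
Proof.
have mU i : measurable (U i : set (Omega * borel X)).
  by apply: open_prod_measurable => //; exact: (open_measurable Omega_borel).
split.
  by split=> [i|]; [exact: measurableI|rewrite -setI_bigcupl U_cover setTI].
have [W [WU WV]] := clopen_partition_seq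
  (prod_compact Omega_compact X_compact) (@prod_hausdorff R d Omega X)
  (prod_zero_dim Omega_zero_dim X_zero_dim) U_open U_cover.
have mW n i : measurable (W n i : set (Omega * borel X)).
  case: (WU n) => cW _ _ _.
  exact: (clopen_measurable Omega_compact X_compact Omega_borel (cW i)).
have mWE n i : measurable (W n i `&` E : set (Omega * borel X)).
  exact: measurableI.
exists (fun n i => W n i `&` E); split.
- move=> n; have [_ WT tW sWU] := WU n; split; last first.
    by move=> i z [Wz Ez]; split => //; exact: sWU.
  split; last by move=> i j _ _ [z [[Wi _] [Wj _]]]; apply: tW => //; exists z.
  by split=> //; rewrite -setI_bigcupl WT setTI.
- move=> n; apply: aeW => w i; apply: clopen_xsectionI.
  by case: (WU n).
move=> beta mu [[[mbeta betaE] tbeta] betaU] [muP muE].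
have betaE' i : beta i `<=` E by rewrite -betaE => z bz; exists i.
pose H n := (cond_entropy mu E beta
    (join_sigma E (fun i => W n i `&` E) (base_sigma E)) +
  cond_entropy mu E (fun i => W n i `&` E)
    (join_sigma E beta (base_sigma E)))%E.
have H_le n (e s : R) : (forall i, mu (beta i `\` (W n i `&` E)) <= e%:E)%E ->
    (forall i, mu ((W n i `&` E) `\` beta i) <= e%:E)%E -> 0 < s < 1 ->
    (0 <= H n <= (((e + - ln s * e + s) *+ N) *+ 2)%:E)%E.
  move=> bW Wb s01; have WE i : W n i `&` E `<=` E by exact: subIsetr.
  have /andP[H10 H1] := cond_entropy_bounds mbeta (mWE n) WE Wb bW s01.
  have /andP[H20 H2] := cond_entropy_bounds (mWE n) mbeta betaE' bW Wb s01.
  by rewrite adde_ge0// mulr2n EFinD; exact: leeD.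
change (ereal_inf (range H) = 0%E).
apply/eqP; rewrite eq_le; apply/andP; split; last first.
  apply: le_ereal_inf_tmp => _ [n _ <-].
  have half01 : 0 < (2^-1 : R) < 1 by rewrite invr_gt0 invf_lt1 ?ltr0n ?ltr1n.
  have /andP[//] : (0 <= H n <= (((1 + - ln 2^-1 * 1 + 2^-1) *+ N) *+ 2)%:E)%E.
  by apply: H_le half01 => i; apply: probability_le1; apply: measurableD.
apply/lee_addgt0Pr => r r0; rewrite add0e.
(* s and e are chosen so that e * (1 - ln s) and s are at most r' = r / (4 (N + 1)),
   while 2 N terms of size 2 r' have to be summed *)
pose r' := r / 4 / N.+1%:R.
have r'0 : 0 < r' by rewrite !divr_gt0.
pose s := Num.min (2^-1) r'.
have s01 : 0 < s < 1.
  by rewrite lt_min invr_gt0 ltr0n r'0/= gt_min invf_lt1 ?ltr1n.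
have ls : 0 <= - ln s by rewrite oppr_ge0 ln_le0//; case/andP: s01 => _ /ltW.
pose e := r' / (1 - ln s).
have ls1 : 0 < 1 - ln s by lra.
have e0 : 0 < e by rewrite divr_gt0.
have betaU' i : beta i `<=` U i by move=> z /betaU[].
have [V VU Vbeta] := clopen_partition_approximation Omega_compact X_compact
  Omega_zero_dim X_zero_dim Omega_borel muP U_open U_cover mbeta mE betaE tbeta
  betaU' e0.
have [n Wn] := WV V VU.
apply: ge_ereal_inf; exists (H n); first by exists n.
have /andP[_ Hn] : (0 <= H n <= (((e + - ln s * e + s) *+ N) *+ 2)%:E)%E.
  apply: H_le s01 => i; rewrite Wn; last by case: (Vbeta i).
  rewrite setDIr (_ : beta i `\` E = set0) ?setU0; first by case: (Vbeta i).
  by rewrite -subset0 => z [/betaE'].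
apply: le_trans Hn _; rewrite lee_fin -mulrnA.
have -> : r = (r' + r') *+ (N.+1 * 2).
  have -> : r = r' * N.+1%:R *+ 4 by rewrite divfK ?pnatr_eq0// -mulr_natr divfK.
  by rewrite mulr_natr -mulr2n -!mulrnA mulnCA mulnC.
have le_r' : e + - ln s * e + s <= r' + r'.
  apply: lerD; last by rewrite ge_min lexx orbT.
  by rewrite -{1}[e]mul1r -mulrDl mulrC /e divfK// gt_eqF.
apply: le_trans (ler_wMn2r _ le_r') _; apply: ler_wpMn2l; first lra.
by rewrite leq_mul2r leqnSn.
Qed.

End excellent_zero_dimensional.

(** * The zero-dimensional extension *)

Lemma continuous_borel_measurable (R : realType) (S T : pmetricType R)
    (f : S -> T) : continuous f ->
  measurable_fun setT (f : borel S -> borel T).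
Proof.
move=> cf _; apply: smallest_sub.
  exact: (sigma_algebra_image _ (@sigma_algebra_measurable _ (borel S))).
move=> A oA; rewrite /image_set_system/= setTI; apply: sub_sigma_algebra.
by apply: open_comp => // ? _; exact: cf.
Qed.

Lemma closed_eq_within (S T : topologicalType) (D : set S) (f g : S -> T) :
  hausdorff_space T -> closed D -> {within D, continuous f} ->
  {within D, continuous g} -> closed (D `&` [set x | f x = g x]).
Proof.
move=> hT cD cf cg x clx; have Dx : D x.
  by apply: cD => A /clx[y [[Dy _] Ay]]; exists y.
split => //=; apply: hT => A B fA gB.
have /(_ x Dx) {}cf := (subspace_continuousP D f).1 cf.
have /(_ x Dx) {}cg := (subspace_continuousP D g).1 cg.
have cA : \forall y \near x, D y -> A (f y) := cf _ fA.
have cB : \forall y \near x, D y -> B (g y) := cg _ gB.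
have [y [[Dy fgy] [/(_ Dy) Afy /(_ Dy) Bgy]]] := clx _ (filterI cA cB).
by exists (f y); split => //; rewrite fgy.
Qed.

Section itinerary.
Context (R : realType) d (Omega : measurableMetricType R d)
  (P : probability Omega R) (G : groupType) (act : G -> Omega -> Omega)
  (X : pmetricType R) (E : set (Omega * X)) (Fg : G -> Omega -> X -> X).
Hypothesis FE : continuous_bundle_rds P act E Fg.
Local Notation M := (cantor_metric R).
(* num numbers the elements of G, and code the coordinates of a G-indexed family
   of binary sequences. *)
Variables (num : G -> nat) (num_inj : injective num)
  (code : G * nat -> nat) (code_inj : injective code)
  (phi : cantor_space -> X) (phi_cont : continuous phi)
  (phi_surj : forall x, exists c, phi c = x).

(** A point y of M encodes a family of points of X indexed by G: the binary
    sequence [slice g y] is read off y along the indices code (g, n), and phi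
    sends it to the g-th point [itin g y]. *)
Definition slice (g : G) (y : M) : M := fun n => y (code (g, n)).

Definition itin (g : G) (y : M) : X := phi (slice g y).

(** The right shift of the family encoded by y. Entries of y whose index is not a
    code are left alone, which keeps the shifts an action of G. *)
Definition shift (h : G) (y : M) : M := fun k =>
  if pselect (exists p, code p = k) is left ex
  then let p := projT1 (cid ex) in y (code ((p.1 * h)%g, p.2)) else y k.

Lemma shift_code h y g n : shift h y (code (g, n)) = y (code ((g * h)%g, n)).
Proof.
rewrite /shift; case: pselect => [ex|]; last by case; exists (g, n).
by case: (cid ex) => p /= /code_inj ->.
Qed.

Lemma shift_out h y k : (forall p, code p <> k) -> shift h y k = y k.
Proof.
by move=> nk; rewrite /shift; case: pselect => // ex; have [p /nk] := ex.
Qed.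

Lemma shift1 y : shift 1%g y = y.
Proof.
apply/funext => k.
have [[[g n] <-]|/forallNP nk] := pselect (exists p, code p = k).
  by rewrite shift_code mulg1.
by rewrite shift_out.
Qed.

Lemma shiftM g h y : shift g (shift h y) = shift (g * h)%g y.
Proof.
apply/funext => k.
have [[[f n] <-]|/forallNP nk] := pselect (exists p, code p = k).
  by rewrite !shift_code mulgA.
by rewrite !shift_out.
Qed.

Lemma shift_continuous h : continuous (shift h).
Proof.
apply: cantor_continuous => k.
have [[[g n] <-]|/forallNP nk] := pselect (exists p, code p = k).
  under eq_fun do rewrite shift_code.
  exact: (@cantor_coord_continuous R).
under eq_fun do rewrite shift_out//.
exact: (@cantor_coord_continuous R).
Qed.

Lemma itin_shift g h y : itin g (shift h y) = itin (g * h)%g y.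
Proof. by congr phi; apply/funext => n; rewrite /slice shift_code. Qed.

Lemma itin_continuous g : continuous (itin g).
Proof.
move=> y; apply: (@continuous_comp _ _ _ (slice g : M -> cantor_space));
  last exact: phi_cont.
have cs : continuous (slice g : M -> M).
  by apply: cantor_continuous => n; exact: (@cantor_coord_continuous R).
exact: (continuous_comp (cs y) (@cantor_to_space_continuous R _)).
Qed.

(** Every family of points of X is encoded by some y. *)
Lemma itin_surj (x : G -> X) : exists y, forall g, itin g y = x g.
Proof.
have /choice[c cx] : forall g, exists c, phi c = x g by move=> g; exact: phi_surj.
exists (fun k => if pselect (exists p, code p = k) is left ex
  then let p := projT1 (cid ex) in c p.1 p.2 else false).
move=> g; rewrite -cx; congr phi; apply/funext => n; rewrite /slice.
case: pselect => [ex|]; last by case; exists (g, n).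
by case: (cid ex) => p /= /code_inj ->.
Qed.

(** The extension: pairs (w, y) where y encodes the orbit of a point of the fibre
    of E over w. On these the shift acts as the dynamics of E. *)
Definition ext_space : set (Omega * M) :=
  [set z | E (z.1, itin 1%g z.2) /\
    forall g, itin g z.2 = Fg g z.1 (itin 1%g z.2)].

Definition ext_map (h : G) (w : Omega) : M -> M := shift h.

Definition ext_proj (z : Omega * M) : Omega * X := (z.1, itin 1%g z.2).

Lemma measurable_itin g : measurable_fun setT (itin g : borel M -> borel X).
Proof. apply: (@continuous_borel_measurable R M X); exact: itin_continuous. Qed.

Lemma measurable_ext_proj :
  measurable_fun setT (ext_proj : Omega * borel M -> Omega * borel X).
Proof.
apply: measurable_fun_pair; first exact: measurable_fst.
exact: measurableT_comp (measurable_itin _) measurable_snd.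
Qed.

Lemma measurable_ext_space : measurable (ext_space : set (Omega * borel M)).
Proof.
pose E0 : set (Omega * borel M) := ext_proj @^-1` E.
have mE0 : measurable E0.
  rewrite -[E0]setTI; apply: measurable_ext_proj => //.
  exact: rds_measurableE FE.
pose S g : set (Omega * borel M) :=
  E0 `&` [set z | itin g z.2 = Fg g z.1 (itin 1%g z.2)].
have mS g : measurable (S g).
  apply: (@measurable_eq_set R _ _ X E0 (fun z => itin g z.2)
    (fun z => Fg g z.1 (itin 1%g z.2))) => //.
  - exact: rds_compact FE.
  - apply: measurable_funTS.
    exact: measurableT_comp (measurable_itin _) measurable_snd.
  have : measurable_fun E0
      (((fun z => Fg g z.1 z.2) : Omega * borel X -> borel X) \o
       (ext_proj : Omega * borel M -> Omega * borel X)).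
    apply: measurable_comp (rds_measurableE FE) _ (rds_measurable FE g) _.
      by move=> _ [z Ez <-].
    exact: measurable_funTS measurable_ext_proj.
  by [].
(* the conditions over all g in G form a countable family thanks to num *)
have -> : ext_space = \bigcap_n
    (if pselect (exists g, num g = n) is left ex then S (projT1 (cid ex))
     else setT).
  rewrite eqEsubset; split=> [z [Ez Fz] n _|z Sz].
    by case: pselect => //= ex; split => //=; exact: Fz.
  have {}Sz g : S g z.
    have := Sz (num g) I; case: pselect => [ex|]; last by case; exists g.
    by case: (cid ex) => h /= /num_inj ->.
  by split=> [|g]; [case: (Sz 1%g)|case: (Sz g)].
by apply: bigcapT_measurable => n; case: pselect => /=.
Qed.

Lemma ext_rds : continuous_bundle_rds P act ext_space ext_map.
Proof.
split.
- exact: cantor_compact.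
- exact: measurable_ext_space.
- move=> h w y [/= Ey Fy]; split=> [|g] /=; rewrite !itin_shift mul1g.
    by rewrite Fy; exact: rds_maps FE _ _ _ Ey.
  by rewrite (Fy (g * h)%g) (Fy h) (rdsM FE).
- by move=> w y _; exact: shift1.
- move=> h; apply: measurable_funTS.
  exact: measurableT_comp (continuous_borel_measurable (@shift_continuous h))
    measurable_snd.
- by move=> g1 g2 w y _; exact: shiftM.
apply: filterS (rds_fiber FE) => w [[x /xsectionP Ex] Ecomp Fcont]; split.
- have [y yx] := itin_surj (fun g => Fg g w x).
  exists y; apply/xsectionP; split=> [|g] /=; rewrite !yx ?(rds1 FE Ex)//.
- apply: (subclosed_compact _ (@cantor_compact R)) => //.
  pose D : set M := itin 1%g @^-1` xsection E w.
  have cD : closed D.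
    apply: preimage_closed; first by move=> y _; exact: itin_continuous.
    exact: compact_closed (metric_hausdorff (T := X)) Ecomp.
  have -> : xsection ext_space w =
      \bigcap_g (D `&` [set y | itin g y = Fg g w (itin 1%g y)]).
    rewrite eqEsubset; split=> [y /xsectionP[Ey Fy] g _|y Dy].
      by split=> /=; [exact/xsectionP|exact: Fy].
    apply/xsectionP; split=> [|g]; last by case: (Dy g I).
    by case: (Dy 1%g I) => /xsectionP.
  apply: closed_bigI => g _; apply: closed_eq_within => //.
  - exact: metric_hausdorff.
  - exact: continuous_subspaceT (@itin_continuous g).
  apply/subspace_continuousP => y Dy.
  have /(_ _ Dy) Fc := (subspace_continuousP _ _).1 (Fcont g).
  (* the limit within E_w is pulled back along the continuous map itin 1 *)
  apply: cvg_trans Fc => A /= FA.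
  have FA' : \forall y' \near y,
    xsection E w (itin 1%g y') -> A (Fg g w (itin 1%g y')) := itin_continuous FA.
  change (\forall y' \near y, D y' -> A (Fg g w (itin 1%g y'))).
  by apply: filterS FA' => y' AFy' Dy'; exact: AFy'.
by move=> g; apply: continuous_subspaceT; exact: shift_continuous.
Qed.

Lemma ext_factor_map : factor_map P act ext_space ext_map E Fg ext_proj.
Proof.
split.
- by move=> z [].
- by [].
- exact: measurable_funTS measurable_ext_proj.
apply: aeW => w; split.
- by apply: continuous_subspaceT; exact: itin_continuous.
- rewrite eqEsubset; split=> [_ [y /xsectionP[Ey _] <-]|x /xsectionP Ex].
    exact/xsectionP.
  have [y yx] := itin_surj (fun g => Fg g w x).
  exists y; rewrite /= ?yx ?(rds1 FE Ex)//; apply/xsectionP.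
  by split=> [|g] /=; rewrite !yx ?(rds1 FE Ex).
by move=> g y /xsectionP[_ Fy] /=; rewrite itin_shift mul1g Fy.
Qed.

End itinerary.

Unset Implicit Arguments.

Theorem theorem6p11 (R : realType) (d : measure_display)
    (Omega : measurableMetricType R d) (P : probability Omega R)
    (G : groupType) (act : G -> Omega -> Omega)
    (X : pmetricType R) (E : set (Omega * X)) (Fg : G -> Omega -> X -> X)
    (G_countable : countable [set: G]) (G_infinite : infinite_set [set: G])
    (G_amenable : amenable R G)
    (act_mp : mp_action P act)
    (FE : continuous_bundle_rds P act E Fg)
    (Omega_compact : compact [set: Omega])
    (Omega_zero_dim : has_clopen_base Omega)
    (Omega_borel : is_completion_of P (@open Omega))
    (N : nat) (U : 'I_N -> set (Omega * X))
    (U_open : forall i, open (U i))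
    (U_cover : \bigcup_(i in [set: 'I_N]) U i = [set: Omega * X]) :
  factor_excellent P act E Fg (fun i => U i `&` E).
Proof.
have X_compact := rds_compact FE.
have Omega_zd : zero_dimensional Omega.
  apply: clopen_base_zero_dimensional => //.
  exact: hausdorff_accessible (metric_hausdorff (T := Omega)).
split.
  split; last by move=> i; apply: aeW => w; exact: open_xsectionI.
  split=> [i|]; last by rewrite -setI_bigcupl U_cover setTI.
  apply: measurableI; last exact: rds_measurableE FE.
  by apply: open_prod_measurable => //; exact: (open_measurable Omega_borel).
have /pcard_injP[num num_inj] := G_countable.
have {}num_inj : injective num by move=> g h; apply: num_inj; rewrite inE.
pose code (p : G * nat) := choice.pickle (num p.1, p.2).
have code_inj : injective code.
  move=> [g n] [h m] /(pcan_inj (@choice.pickleK _)) [/num_inj -> ->].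
  by [].
have [phi phi_cont] := cantor_surj X_compact (metric_hausdorff (T := X)).
have phi_surj x : exists c, phi c = x.
  by have [c _ cx] := @surj _ _ _ _ phi x I; exists c.
exists (cantor_metric R), (ext_space E Fg code phi), (ext_map code),
  (ext_proj code phi).
split.
- exact: (ext_rds FE num_inj code_inj phi_cont phi_surj).
- exact: (ext_factor_map FE code_inj phi_cont phi_surj).
have -> : (fun i => ext_space E Fg code phi `&`
                    ext_proj code phi @^-1` (U i `&` E)) =
          (fun i => ext_proj code phi @^-1` U i `&` ext_space E Fg code phi).
  apply/funext => i; rewrite eqEsubset; split=> [z [Ez [Uz _]] //|z [Uz Ez]].
  by split=> //; split => //; case: Ez.
apply: zero_dimensional_excellent => //.
- exact: (measurable_ext_space FE num_inj code phi_cont).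
- exact: cantor_compact.
- exact: cantor_zero_dim.
- move=> i; apply: open_comp => // z _.
  apply: cvg_pair; first exact: cvg_fst.
  apply: cvg_comp; first exact: cvg_snd.
  exact: (itin_continuous phi_cont).
by rewrite -preimage_bigcup U_cover preimage_setT.
Qed.
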